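(* Let $n\ge 2$. (1) The groups $\mathrm{Aut}(Q_{D,n})$ and $\mathrm{Aut}(Q_{W,n})$ are each conjugate, in $GL(n+2,\mathbb{R})$, to $\mathrm{Aut}(Q_{\mathcal{L},n}) = O(n+1,1)$. (2) The group $\mathrm{Aut}(Q_{D,n})$ acts transitively on the left (by $\mathbf{W}_{\mathcal D}\mapsto \mathbf{U}\mathbf{W}_{\mathcal D}$) on the space $\mathcal{M}_{\mathbb{D}}^n$ of all ordered, oriented Descartes configurations in $\mathbb{R}^n$. Given two such configurations $\mathcal D$ and $\mathcal D'$, there exists a unique $\mathbf{U}\in \mathrm{Aut}(Q_{D,n})$ such that $\mathbf{U}\mathbf{W}_{\mathcal D}=\mathbf{W}_{\mathcal D'}$. (3) The group $\mathrm{Aut}(Q_{W,n})$ acts transitively on the right (by $\mathbf{W}_{\mathcal D}\mapsto \mathbf{W}_{\mathcal D}\mathbf{V}^{-1}$) on $\mathcal{M}_{\mathbb{D}}^n$. Given two ordered, oriented Descartes configurations $\mathcal D$ and $\mathcal D'$, there exists a unique $\mathbf{V}\in \mathrm{Aut}(Q_{W,n})$ such that $\mathbf{W}_{\mathcal D}\mathbf{V}^{-1}=\mathbf{W}_{\mathcal D'}$.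
   Context: Quadratic forms in $n+2$ variables are identified with symmetric matrices: $\mathbf{Q}_{D,n}=\mathbf{I}_{n+2}-\frac1n\mathbf{1}\mathbf{1}^T$ with $\mathbf 1=(1,\dots,1)^T$ (Descartes form); $\mathbf{Q}_{W,n}=\begin{pmatrix}0&-4&0\\-4&0&0\\0&0&2\mathbf{I}_n\end{pmatrix}$ (Wilker form); $\mathbf{Q}_{\mathcal L,n}=\mathrm{diag}(-1,1,\dots,1)$ (Lorentz form). For a form $Q$ with matrix $\mathbf Q$, $\mathrm{Aut}(Q)=\{\mathbf U\in GL(n+2,\mathbb R):\mathbf U^T\mathbf Q\mathbf U=\mathbf Q\}$. ''Sphere'' means an $(n-1)$-sphere in $\mathbb R^n$, hyperplanes being allowed as degenerate spheres (passing through $\infty$). An oriented sphere is a sphere with a chosen direction of unit normal; its signed curvature is $b=1/r$ for the inward normal and $b=-1/r$ for the outward normal ($r$ the radius), and its interior is the usual interior for the inward normal and the exterior for the outward normal. An oriented hyperplane has signed curvature $0$ and its interior is the open half-space into which its chosen unit normal points. A Descartes configuration in $\mathbb R^n$ consists of $n+2$ pairwise tangent spheres with all points of tangency distinct (parallel hyperplanes are tangent at $\infty$). It is oriented if its spheres are oriented so that either the interiors of all $n+2$ oriented spheres are pairwise disjoint, or they are pairwise disjoint after reversing all orientations. $\mathcal M_{\mathbb D}^n$ is the set of ordered, oriented Descartes configurations in $\mathbb{R}^n$. The augmented curvature-center coordinates of an oriented sphere $S$ with signed curvature $b\neq0$ and center $(x_1,\dots,x_n)$ are the row vector $\mathbf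 w(S)=(\bar b,b,bx_1,\dots,bx_n)$, where $\bar b$ is the signed curvature of the oriented sphere or hyperplane obtained from $S$ by the inversion $\mathbf x\mapsto \mathbf x/|\mathbf x|^2$, i.e. $\bar b=b|\mathbf x|^2-1/b$. For an oriented hyperplane $\{\mathbf y:\mathbf y\cdot\mathbf h=m\}$ with unit normal $\mathbf h$, $\mathbf w=(2m,0,h_1,\dots,h_n)$. For an ordered, oriented Descartes configuration $\mathcal D=(S_1,\dots,S_{n+2})$, $\mathbf W_{\mathcal D}$ is the $(n+2)\times(n+2)$ matrix with $j$-th row $\mathbf w(S_j)$. Known fact: $\mathcal D\mapsto\mathbf W_{\mathcal D}$ is a bijection from $\mathcal M^n_{\mathbb D}$ onto the set of real matrices $\mathbf W$ with $\mathbf W^T\mathbf Q_{D,n}\mathbf W=\mathbf Q_{W,n}$; the group actions are on $\mathcal M_{\mathbb D}^n$ through this identification. *)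

(* Defs.v *)
From HB Require Import structures.
From mathcomp Require Import all_boot all_order all_algebra.
From mathcomp Require Import classical_sets reals.

Set Implicit Arguments.
Unset Strict Implicit.
Unset Printing Implicit Defensive.

Import Order.TTheory GRing.Theory Num.Theory.

Local Open Scope classical_set_scope.
Local Open Scope ring_scope.

Section Forms.
Variables (R : realType) (n : nat).

Definition QDescartes : 'M[R]_n.+2 :=
  1%:M - n%:R^-1 *: (const_mx 1 *m (const_mx 1 : 'cV[R]_n.+2)^T).

Definition QWilker : 'M[R]_n.+2 :=
  block_mx (\matrix_(i < 2, j < 2) (if i == j then 0 else - 4)) 0
           0                                                    2%:M
  : 'M[R]_(2 + n).

Definition QLorentz : 'M[R]_n.+2 :=
  diag_mx (row_mx (const_mx (- 1)) (const_mx 1) : 'rV[R]_(1 + n.+1)).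

End Forms.

Section Groups.
Variables (R : realType) (k : nat).

Definition autform (Q : 'M[R]_k) : set 'M[R]_k :=
  [set U | U \in unitmx /\ U^T *m Q *m U = Q].

Definition conjugate_in_GL (G H : set 'M[R]_k) : Prop :=
  exists2 P : 'M[R]_k, P \in unitmx &
    G = [set P *m A *m invmx P | A in H].

Variables (T : Type) (G : set 'M[R]_k) (X : set T) (act : 'M[R]_k -> T -> T).

Definition acts_on : Prop :=
  [/\ forall g x, G g -> X x -> X (act g x),
      forall x, X x -> act 1%:M x = x
    & forall g h x, G g -> G h -> X x -> act (g *m h) x = act g (act h x)].

Definition transitive_on : Prop :=
  X !=set0 /\ forall x y, X x -> X y -> exists2 g, G g & act g x = y.

End Groups.

Section Spheres.
Variables (R : realType) (n : nat).
Implicit Types (x y h : 'rV[R]_n) (m r : R).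

(* The norm `|x| that the library puts on matrices is the sup norm, hence the
   Euclidean norm below. *)
Definition dotv x y : R := (x *m y^T) 0 0.
Definition enorm x : R := Num.sqrt (dotv x x).

Lemma enormN x : enorm (- x) = enorm x.
Proof. by rewrite /enorm /dotv linearN /= mulNmx mulmxN opprK. Qed.

(* [OSphere c r _ inward] has center [c], radius [r] and unit normal pointing
   inward or outward; [OPlane h m _] is the hyperplane y . h = m with chosen
   unit normal [h].  Each oriented sphere is represented exactly once. *)
Inductive osphere : Type :=
| OSphere (c : 'rV[R]_n) (r : R) of 0 < r & bool
| OPlane (h : 'rV[R]_n) (m : R) of enorm h = 1.

Definition oreverse (S : osphere) : osphere :=
  match S with
  | OSphere c r r_gt0 inward => OSphere c r_gt0 (~~ inward)
  | OPlane h m h1 => OPlane (- m) (etrans (enormN h) h1)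
  end.

(* Points of the extended space R^n together with infinity, which is [None]. *)
Definition opoints (S : osphere) : set (option 'rV[R]_n) :=
  match S with
  | OSphere c r _ _ => [set p | if p is Some y then enorm (y - c) = r else False]
  | OPlane h m _ => [set p | if p is Some y then dotv y h = m else True]
  end.

Definition ointerior (S : osphere) : set 'rV[R]_n :=
  match S with
  | OSphere c r _ true => [set y | enorm (y - c) < r]
  | OSphere c r _ false => [set y | r < enorm (y - c)]
  | OPlane h m _ => [set y | m < dotv y h]
  end.

(* For n >= 2, spheres and hyperplanes are tangent exactly when they have a
   single common point in the extended space; distinct parallel hyperplanes
   are tangent at infinity. *)
Definition tangent_at (p : option 'rV[R]_n) (S S' : osphere) : Prop :=
  opoints S `&` opoints S' = [set p].

Definition descartes_config (D : 'I_n.+2 -> osphere) : Prop :=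
  (forall i j, i != j -> exists p, tangent_at p (D i) (D j)) /\
  (forall (i j k l : 'I_n.+2) p, (i < j)%N -> (k < l)%N ->
     tangent_at p (D i) (D j) -> tangent_at p (D k) (D l) -> i = k /\ j = l).

Definition disjoint_interiors (D : 'I_n.+2 -> osphere) : Prop :=
  trivIset [set: 'I_n.+2] (fun i => ointerior (D i)).

Definition descartes_space : set ('I_n.+2 -> osphere) :=
  [set D | descartes_config D /\
           (disjoint_interiors D \/ disjoint_interiors (fun i => oreverse (D i)))].

Definition augcoord (a b : R) (v : 'rV[R]_n) : 'rV[R]_n.+2 :=
  row_mx (row_mx a%:M b%:M : 'rV[R]_(1 + 1)) v : 'rV[R]_(2 + n).

(* The first coordinate is the signed curvature of the image under
   x |-> x / |x|^2. *)
Definition acc_coord (S : osphere) : 'rV[R]_n.+2 :=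
  match S with
  | OSphere c r _ inward =>
      let b := if inward then r^-1 else - r^-1 in
      augcoord (b * enorm c ^+ 2 - b^-1) b (b *: c)
  | OPlane h m _ => augcoord (2 * m) 0 h
  end.

Definition acc_matrix (D : 'I_n.+2 -> osphere) : 'M[R]_n.+2 :=
  \matrix_(i < n.+2) acc_coord (D i).

End Spheres.

(* Main.v *)
(* Write an oriented sphere as its row w = (bbar, b, v) of augmented
   curvature-center coordinates, and rescale the inverse of the Wilker form so
   that <w, w'> = v.v' - (bbar b' + b bbar') / 2.  Oriented spheres are exactly
   the vectors with <w, w> = 1, and points of the extended space are the rays of
   the light cone, the finite point y being the ray of N(y) = (|y|^2, 1, y);
   <w, N(y)> vanishes on the sphere and is positive in its interior.  If two
   spheres meet at one point p then <w, w'> = 1 or -1, and disjointness of the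
   interiors forces -1.  Conversely, if <w, w'> = -1 then w + w' is null, hence
   a multiple of some N(p), so the spheres meet only at p and either their
   interiors or those of the reversed spheres are disjoint, according to the
   half of the light cone containing w + w'; for n + 2 spheres with all mutual
   products equal to -1 these halves agree.  Thus Descartes configurations are
   the matrices W whose rows have Gram matrix 2 Q_D^-1, that is,
   W^T Q_D W = Q_W, and on these both groups act simply transitively. *)

Require Import Defs.
From HB Require Import structures.
From mathcomp Require Import all_boot all_order all_algebra.
From mathcomp Require Import classical_sets reals.
From mathcomp Require Import boolp ring lra.

Set Implicit Arguments.
Unset Strict Implicit.
Unset Printing Implicit Defensive.

Import Order.TTheory GRing.Theory Num.Theory.

Local Open Scope classical_set_scope.
Local Open Scope ring_scope.

(** * The Euclidean inner product on row vectors *)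

Section Dot.
Variables (R : realType) (n : nat).
Implicit Types (x y z g h v : 'rV[R]_n) (k : R).

Lemma dotvE x y : dotv x y = \sum_i x 0 i * y 0 i.
Proof. by rewrite /dotv mxE; apply: eq_bigr => i _; rewrite mxE. Qed.

Lemma dotvC x y : dotv x y = dotv y x.
Proof. by rewrite !dotvE; apply: eq_bigr => i _; rewrite mulrC. Qed.

Lemma dotvDl x y z : dotv (x + y) z = dotv x z + dotv y z.
Proof. by rewrite /dotv mulmxDl mxE. Qed.

Lemma dotvDr x y z : dotv z (x + y) = dotv z x + dotv z y.
Proof. by rewrite !(dotvC z) dotvDl. Qed.

Lemma dotvZl k x y : dotv (k *: x) y = k * dotv x y.
Proof. by rewrite /dotv -scalemxAl mxE. Qed.

Lemma dotvZr k x y : dotv x (k *: y) = k * dotv x y.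
Proof. by rewrite !(dotvC x) dotvZl. Qed.

Lemma dotvNl x y : dotv (- x) y = - dotv x y.
Proof. by rewrite -scaleN1r dotvZl mulN1r. Qed.

Lemma dotvNr x y : dotv x (- y) = - dotv x y.
Proof. by rewrite !(dotvC x) dotvNl. Qed.

Lemma dotv0l x : dotv 0 x = 0.
Proof. by rewrite -(scale0r 0) dotvZl mul0r. Qed.

Lemma dotv0r x : dotv x 0 = 0.
Proof. by rewrite dotvC dotv0l. Qed.

Definition dotv_lin :=
  (dotvDl, dotvDr, dotvZl, dotvZr, dotvNl, dotvNr, dotv0l, dotv0r).

Lemma dotv_ge0 x : 0 <= dotv x x.
Proof. by rewrite dotvE sumr_ge0 // => i _; rewrite -expr2 sqr_ge0. Qed.

Lemma dotv_eq0 x : (dotv x x == 0) = (x == 0).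
Proof.
apply/eqP/eqP => [|->]; last by rewrite dotv0l.
rewrite dotvE => /eqP; rewrite psumr_eq0 => [/allP x0|i _]; last first.
  by rewrite -expr2 sqr_ge0.
apply/rowP => i; rewrite mxE; apply/eqP.
by have := x0 i (mem_index_enum i); rewrite -expr2 sqrf_eq0.
Qed.

Lemma dotv_sub_eq0 x y : dotv x x - 2 * dotv x y + dotv y y = 0 -> x = y.
Proof.
move=> xy; apply/eqP; rewrite -subr_eq0 -dotv_eq0 !dotv_lin (dotvC y x).
by apply/eqP; rewrite -[RHS]xy; ring.
Qed.

Lemma enorm_ge0 x : 0 <= enorm x.
Proof. exact: sqrtr_ge0. Qed.

Lemma enorm_sqr x : enorm x ^+ 2 = dotv x x.
Proof. by rewrite sqr_sqrtr ?dotv_ge0. Qed.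

Lemma enorm_eq1 x : enorm x = 1 <-> dotv x x = 1.
Proof.
by split=> [x1|x1]; [rewrite -enorm_sqr x1 expr1n|rewrite /enorm x1 sqrtr1].
Qed.

(** The Gram determinant of [g] and [h] is 1 - (g.h)^2, so Cramer's rule gives a solution in their
    span. It supplies common points of spheres that cross. *)
Lemma dotv_unit_solve g h (a b : R) : dotv g g = 1 -> dotv h h = 1 ->
  dotv g h ^+ 2 != 1 -> exists z, dotv g z = a /\ dotv h z = b.
Proof.
set c := dotv g h => g1 h1 c1.
have d0 : 1 - c ^+ 2 != 0 by rewrite subr_eq0 eq_sym.
exists (((a - c * b) / (1 - c ^+ 2)) *: g + ((b - c * a) / (1 - c ^+ 2)) *: h).
by rewrite !dotv_lin (dotvC h g) -/c g1 h1; split; field.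
Qed.

End Dot.

(** * Inverse forms, the Lorentzian product on coordinate rows, and its null vectors *)

Section Pairing.
Variables (R : realType) (n : nat).

(** Sherman-Morrison: since 1^T 1 = n + 2, the coefficient is (1/n) / (1 - (n+2)/n) = -1/2, whatever
    [n] is. *)
Definition QDescartes_inv : 'M[R]_n.+2 :=
  1%:M - 2^-1 *: (const_mx 1 *m (const_mx 1 : 'cV[R]_n.+2)^T).

Definition QWilker_inv : 'M[R]_n.+2 :=
  block_mx (\matrix_(i < 2, j < 2) (if i == j then 0 else - 4^-1)) 0
           0 (2^-1)%:M
  : 'M[R]_(2 + n).

Lemma mul_ones : (const_mx 1 : 'cV[R]_n.+2)^T *m const_mx 1 = (n.+2)%:R%:M.
Proof.
apply/matrixP => i j; rewrite !ord1 !mxE eqxx mulr1n.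
under eq_bigr do rewrite !mxE mulr1.
by rewrite sumr_const card_ord.
Qed.

Lemma mul_QDescartes_inv : (0 < n)%N -> QDescartes R n *m QDescartes_inv = 1%:M.
Proof.
move=> n0; rewrite /QDescartes /QDescartes_inv; set o := const_mx 1.
have n0R : n%:R != 0 :> R by rewrite pnatr_eq0 -lt0n.
rewrite mulmxBl mul1mx mulmxBr mulmx1 -scalemxAl -scalemxAr.
rewrite -mulmxA (mulmxA o^T) mul_ones mul_scalar_mx -scalemxAr !scalerA.
have -> : n.+2%:R = n%:R + 2 :> R by rewrite -addn2 natrD.
by apply/matrixP => i j; rewrite !mxE; field; rewrite n0R.
Qed.

Lemma mul_QWilker_inv : QWilker R n *m QWilker_inv = 1%:M.
Proof.
rewrite /QWilker /QWilker_inv (@mulmx_block _ 2 n 2 n 2 n).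
rewrite !(mulmx0, mul0mx, addr0, add0r) -scalar_mxM mulfV ?pnatr_eq0 //.
rewrite [X in block_mx X](_ : _ = 1%:M) ?[RHS](@scalar_mx_block _ 2 n) //.
apply/matrixP => i j; rewrite !mxE !big_ord_recl big_ord0 !mxE.
by case: i => [[|[|//]] ?]; case: j => [[|[|//]] ?]; rewrite !eqE /=; field.
Qed.

Definition pairing (w w' : 'rV[R]_n.+2) : R := 2 * (w *m QWilker_inv *m w'^T) 0 0.

Lemma pairing_augcoord (a b a' b' : R) (v v' : 'rV[R]_n) :
  pairing (augcoord a b v) (augcoord a' b' v') =
  dotv v v' - (a * b' + b * a') / 2.
Proof.
rewrite /pairing /augcoord /QWilker_inv (@mul_row_block _ 1 2 n 2 n).
rewrite !(mulmx0, mul0mx, addr0, add0r) (@tr_row_mx _ 1 2 n).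
rewrite (@mul_row_col _ 1 2 n) mxE mul_mx_scalar -scalemxAl.
rewrite [X in _ * (_ + X)]mxE -/(dotv v v') mxE.
rewrite !big_ord_recl big_ord0 !mxE !big_ord_recl !big_ord0 !mxE.
rewrite !eqE /=.
have -> : @split 1 1 ord0 = inl 0.
  by rewrite -[RHS]unsplitK; congr split; apply: val_inj.
have -> : @split 1 1 (lift ord0 ord0) = inr 0.
  by rewrite -[RHS]unsplitK; congr split; apply: val_inj.
by rewrite !mxE !eqxx !mulr1n; field.
Qed.

Lemma augcoord_surj (w : 'rV[R]_n.+2) : exists a b v, w = augcoord a b v.
Proof.
pose l : 'rV_(1 + 1) := @lsubmx _ 1 2 n w.
exists (lsubmx l 0 0), (rsubmx l 0 0), (@rsubmx _ 1 2 n w).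
by rewrite /augcoord -!mx11_scalar hsubmxK (@hsubmxK _ 1 2 n).
Qed.

Lemma augcoord_inj (a b a' b' : R) (v v' : 'rV[R]_n) :
  augcoord a b v = augcoord a' b' v' -> [/\ a = a', b = b' & v = v'].
Proof.
rewrite /augcoord => /(@eq_row_mx _ 1 2 n)
  [/(@eq_row_mx _ 1 1 1)[/matrixP/(_ 0 0) + /matrixP/(_ 0 0)]].
by rewrite !mxE !mulr1n.
Qed.

Lemma augcoordN (a b : R) (v : 'rV[R]_n) :
  - augcoord a b v = augcoord (- a) (- b) (- v).
Proof.
by rewrite /augcoord (@opp_row_mx _ 1 2 n) (@opp_row_mx _ 1 1 1)
  -!(raddfN (@scalar_mx R 1)).
Qed.

Lemma augcoordZ k (a b : R) (v : 'rV[R]_n) :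
  k *: augcoord a b v = augcoord (k * a) (k * b) (k *: v).
Proof.
by rewrite /augcoord (@scale_row_mx _ 1 2 n) (@scale_row_mx _ 1 1 1)
  !scale_scalar_mx.
Qed.

Lemma pairingC w w' : pairing w w' = pairing w' w.
Proof.
have [a [b [v ->]]] := augcoord_surj w;
have [a' [b' [v' ->]]] := augcoord_surj w'.
by rewrite !pairing_augcoord dotvC; ring.
Qed.

Lemma pairingDl w1 w2 w : pairing (w1 + w2) w = pairing w1 w + pairing w2 w.
Proof. by rewrite /pairing !mulmxDl mxE mulrDr. Qed.

Lemma pairingDr w1 w2 w : pairing w (w1 + w2) = pairing w w1 + pairing w w2.
Proof. by rewrite !(pairingC w) pairingDl. Qed.

Lemma pairingZl k w w' : pairing (k *: w) w' = k * pairing w w'.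
Proof. by rewrite /pairing -!scalemxAl mxE; ring. Qed.

Lemma pairingZr k w w' : pairing w (k *: w') = k * pairing w w'.
Proof. by rewrite !(pairingC w) pairingZl. Qed.

Lemma pairingNN w w' : pairing (- w) (- w') = pairing w w'.
Proof. by rewrite -!(scaleN1r _) pairingZl pairingZr; ring. Qed.

(** The vector for infinity is the limit of N(y) / |y|^2 as |y| grows. *)
Definition null_vector (p : option 'rV[R]_n) : 'rV[R]_n.+2 :=
  if p is Some y then augcoord (dotv y y) 1 y else augcoord 1 0 0.

(** For finite points the product is -|y - z|^2 / 2; with exactly one point at infinity it is
    -1/2. *)
Lemma pairing_null_le0 p q : pairing (null_vector p) (null_vector q) <= 0.
Proof.
case: p q => [y|] [z|]; rewrite pairing_augcoord ?dotv_lin; try lra.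
have := dotv_ge0 (y - z); rewrite !dotv_lin (dotvC z y); lra.
Qed.

Lemma pairing_null_eq0 p q : pairing (null_vector p) (null_vector q) = 0 <-> p = q.
Proof.
split=> [|->].
  case: p q => [y|] [z|]; rewrite pairing_augcoord ?dotv_lin // => yz.
  - by congr Some; apply: dotv_sub_eq0; lra.
  - by exfalso; lra.
  - by exfalso; lra.
by case: q => [z|]; rewrite pairing_augcoord ?dotv_lin; lra.
Qed.

(** Nullity says v.v = a b. If b is nonzero, factoring it out leaves N(v/b); if b = 0 then v = 0 and
    only the direction of infinity remains. *)
Lemma null_vectorP u : u != 0 -> pairing u u = 0 ->
  exists k p, k != 0 /\ u = k *: null_vector p.
Proof.
have [a [b [v ->]]] := augcoord_surj u; rewrite pairing_augcoord => u0 uu.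
have [b0|b0] := eqVneq b 0; last first.
  exists b, (Some (b^-1 *: v)); split=> //=.
  rewrite augcoordZ !dotv_lin scalerA mulfV // scale1r mulr1; congr augcoord.
  have -> : dotv v v = a * b by lra.
  by field.
move: u0 uu; rewrite {}b0 mulr0 mul0r addr0 mul0r subr0 => u0 /eqP.
rewrite dotv_eq0 => /eqP v0; move: u0; rewrite {}v0 => u0.
exists a, None; rewrite /= augcoordZ mulr1 mulr0 scaler0; split=> //.
apply: contra_neq u0 => ->.
by rewrite /augcoord raddf0 !row_mx0.
Qed.

End Pairing.

(** * Oriented spheres as unit vectors, and the product of two tangent spheres *)

Section Coordinates.
Variables (R : realType) (n : nat).
Implicit Types (S : osphere R n) (w : 'rV[R]_n.+2).

(** At a finite y the product is b (r^2 - |y - c|^2) / 2 for a sphere and h.y - m for a hyperplane;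
    at infinity it is -b/2, which vanishes exactly for hyperplanes. *)
Lemma opointsE S p :
  opoints S p <-> pairing (acc_coord S) (null_vector p) = 0.
Proof.
case: S => [c r r0 o|h m h1]; case: p => [y|] /=;
rewrite pairing_augcoord ?dotv_lin.
- have -> : (enorm (y - c) = r) <-> (dotv (y - c) (y - c) = r ^+ 2).
    rewrite -enorm_sqr; split=> [->//|/eqP].
    by rewrite eqrXn2 ?enorm_ge0 ?(ltW r0) // => /eqP.
  rewrite enorm_sqr !dotv_lin (dotvC y c).
  have r0' := lt0r_neq0 r0.
  set b := if o then _ else _.
  have bb : b ^-1 = b * r ^+ 2 by rewrite /b; case: (o); field.
  have b0 : b != 0 by rewrite /b; case: (o); rewrite ?oppr_eq0 invr_eq0.
  rewrite bb; split=> [e|].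
    by rewrite -e; field.
  move=> e; apply/eqP; rewrite -subr_eq0; apply/eqP.
  by apply: (mulfI b0); rewrite mulr0 -[RHS](mulr0 (-2)) -[in RHS]e; field.
- have r0' := lt0r_neq0 r0.
  set b := if o then _ else _.
  have b0 : b != 0 by rewrite /b; case: (o); rewrite ?oppr_eq0 invr_eq0.
  split=> // e; case/eqP: b0; lra.
- by rewrite dotvC; split; lra.
- by split=> //; lra.
Qed.

Lemma ointeriorE S y :
  ointerior S y <-> 0 < pairing (acc_coord S) (null_vector (Some y)).
Proof.
case: S => [c r r0 o|h m h1] /=; rewrite pairing_augcoord ?dotv_lin; last first.
  by rewrite dotvC; split; lra.
have r0' := lt0r_neq0 r0.
set e : R := _ - _.
have -> : e = (if o then 1 else -1) *
    ((2 * r)^-1 * (r ^+ 2 - enorm (y - c) ^+ 2)).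
  rewrite /e !enorm_sqr !dotv_lin (dotvC y c).
  by case: (o); field.
have r2 : 0 < (2 * r)^-1 by rewrite invr_gt0 mulr_gt0.
case: (o); rewrite /= ?mul1r ?mulN1r ?oppr_gt0
  ?(pmulr_rgt0 _ r2) ?(pmulr_rlt0 _ r2).
  by rewrite subr_gt0 ltr_pXn2r ?nnegrE ?enorm_ge0 ?(ltW r0).
by rewrite subr_lt0 ltr_pXn2r ?nnegrE ?enorm_ge0 ?(ltW r0).
Qed.

Lemma acc_coord_norm S : pairing (acc_coord S) (acc_coord S) = 1.
Proof.
case: S => [c r r0 o|h m h1]; rewrite pairing_augcoord ?dotv_lin; last first.
  by move/enorm_eq1: (h1) => ->; lra.
have r0' := lt0r_neq0 r0; rewrite enorm_sqr.
by case: (o); field.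
Qed.

Lemma acc_coord_surj w : pairing w w = 1 -> exists S, acc_coord S = w.
Proof.
have [a [b [v ->]]] := augcoord_surj w; rewrite pairing_augcoord.
have [->|b0] := eqVneq b 0 => w1.
  have v1 : enorm v = 1 by apply/enorm_eq1; lra.
  by exists (OPlane (a / 2) v1) => /=; congr augcoord; field.
have r0 : 0 < `|b|^-1 by rewrite invr_gt0 normr_gt0.
(* The sign of b gives the orientation, |b|^-1 the radius and v/b the center; the norm condition
   then fixes the first coordinate. *)
exists (OSphere (b^-1 *: v) r0 (0 < b)).
have eb : (if 0 < b then `|b|^-1^-1 else - `|b|^-1^-1) = b.
  by rewrite invrK; case: ltrgt0P b0 => // _ _; rewrite opprK.
rewrite /acc_coord eb enorm_sqr !dotv_lin scalerA mulfV // scale1r.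
have -> : dotv v v = 1 + a * b by lra.
by congr augcoord; field.
Qed.

Lemma acc_coord_inj : injective (@acc_coord R n).
Proof.
case=> [c r r0 o|h m h1] [c' r' r0' o'|h' m' h1'] /= /augcoord_inj [].
- set b := if o then _ else _; set b' := if o' then _ else _.
  move=> _ bb cc.
  have b0 : b != 0.
    by rewrite /b; case: (o); rewrite ?oppr_eq0 invr_eq0 (lt0r_neq0 r0).
  have sb : (0 < b) = o.
    by rewrite /b; case: (o);
    rewrite ?oppr_gt0 ?invr_gt0 ?invr_lt0 ?r0 // ltNge ltW.
  have sb' : (0 < b') = o'.
    by rewrite /b'; case: (o');
    rewrite ?oppr_gt0 ?invr_gt0 ?invr_lt0 ?r0' // ltNge ltW.
  have rb : r = `|b|^-1.
    by rewrite /b; case: (o); rewrite ?normrN gtr0_norm ?invr_gt0 ?invrK.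
  have rb' : r' = `|b'|^-1.
    by rewrite /b'; case: (o'); rewrite ?normrN gtr0_norm ?invr_gt0 ?invrK.
  have ec : c = c' by apply: (scalerI b0); rewrite cc bb.
  have er : r = r' by rewrite rb rb' bb.
  have eo : o = o' by rewrite -sb -sb' bb.
  clear sb sb' rb rb' cc bb b0; subst c' r' o'.
  by rewrite (bool_irrelevance r0 r0').
- by move=> _ /eqP; case: (o); rewrite ?oppr_eq0 invr_eq0 (negPf (lt0r_neq0 r0)).
- by move=> _ /esym/eqP; case: (o');
  rewrite ?oppr_eq0 invr_eq0 (negPf (lt0r_neq0 r0')).
- move=> mm _ hh; have em : m = m' by lra.
  by subst h' m'; rewrite (eq_irrelevance h1 h1').
Qed.

Lemma acc_coord_reverse S : acc_coord (oreverse S) = - acc_coord S.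
Proof.
case: S => [c r r0 o|h m h1] /=; rewrite augcoordN ?oppr0 -?scaleNr ?mulrN //.
by case: o; rewrite /= ?opprK ?invrN; congr augcoord; ring.
Qed.

Lemma opoints_reverse S : opoints (oreverse S) = opoints S.
Proof.
apply/seteqP; split=> p /opointsE e; apply/opointsE; move: e;
rewrite acc_coord_reverse -scaleN1r pairingZl; lra.
Qed.

(** At a common point the product equals the inner product c of the unit normals. If c^2 differs
    from 1 there is a second common point; if c = 1 the interiors overlap; only c = -1 is left. *)
Lemma pairing_tangent p S S' : tangent_at p S S' ->
  ointerior S `&` ointerior S' = set0 ->
  pairing (acc_coord S) (acc_coord S') = -1.
Proof.
move=> tp dis.
have nodis y : 0 < pairing (acc_coord S) (null_vector (Some y)) ->
    0 < pairing (acc_coord S') (null_vector (Some y)) -> False.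
  move=> /ointeriorE Sy /ointeriorE S'y.
  by suff: (set0 : set 'rV[R]_n) y by []; rewrite -dis.
have uniq q : pairing (acc_coord S) (null_vector q) = 0 ->
    pairing (acc_coord S') (null_vector q) = 0 -> q = p.
  move=> /opointsE Sq /opointsE S'q.
  by suff: [set p] q by []; rewrite -tp.
have [/opointsE Sp /opointsE S'p] : (opoints S `&` opoints S') p by rewrite tp.
move: (acc_coord_norm S) (acc_coord_norm S') Sp S'p uniq nodis.
have [a [b [v ->]]] := augcoord_surj (acc_coord S).
have [a' [b' [v' ->]]] := augcoord_surj (acc_coord S').
rewrite !pairing_augcoord; case: p {tp dis} => [y|] /=; last first.
  rewrite !pairing_augcoord !dotv_lin => w1 w1' bz bz' uniq nodis.
  have {bz} b0 : b = 0 by lra.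
  have {bz'} b0' : b' = 0 by lra.
  subst b b'.
  (* Tangency at infinity: both are hyperplanes, and independent normals would give them a finite
     common point. *)
  have [/eqP|c1] := eqVneq (dotv v v' ^+ 2) 1; last first.
    have v1 : dotv v v = 1 by lra.
    have v1' : dotv v' v' = 1 by lra.
    have [z [za zb]] := dotv_unit_solve (a / 2) (a' / 2) v1 v1' c1.
    have //: Some z = None.
    by apply: uniq; rewrite pairing_augcoord ?za ?zb; lra.
  rewrite sqrf_eq1 => /orP[/eqP c1|/eqP c1]; last by rewrite c1; lra.
  have ev : v = v' by apply: dotv_sub_eq0; lra.
  (* With equal normals, a point far enough along [v] lies in both half-spaces. *)
  subst v'; case: (nodis ((`|a| + `|a'| + 1) *: v));
  rewrite pairing_augcoord dotv_lin c1.
    have := ler_norm a; have := normr_ge0 a; have := normr_ge0 a'; lra.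
  have := ler_norm a'; have := normr_ge0 a; have := normr_ge0 a'; lra.
(* [g] and [g'] are the unit normals of the two spheres at [y]. *)
rewrite !pairing_augcoord => w1 w1' fy fy' uniq nodis.
pose g := v - b *: y; pose g' := v' - b' *: y.
have vy : dotv v y = (a + b * dotv y y) / 2 by lra.
have vy' : dotv v' y = (a' + b' * dotv y y) / 2 by lra.
have vv : dotv v v = 1 + a * b by lra.
have vv' : dotv v' v' = 1 + a' * b' by lra.
have g1 : dotv g g = 1 by rewrite !dotv_lin (dotvC y) vy vv; field.
have g1' : dotv g' g' = 1 by rewrite !dotv_lin (dotvC y) vy' vv'; field.
have gg' : dotv g g' = dotv v v' - (a * b' + b * a') / 2.
  by rewrite !dotv_lin (dotvC y) vy vy'; field.
rewrite -gg'.
(* Expansion around y; the constant term is absent because y lies on the sphere. *)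
have move_by z : pairing (augcoord a b v) (null_vector (Some (y + z))) =
    dotv g z - b * dotv z z / 2.
  by rewrite pairing_augcoord !dotv_lin (dotvC z y) vy; field.
have move_by' z : pairing (augcoord a' b' v') (null_vector (Some (y + z))) =
    dotv g' z - b' * dotv z z / 2.
  by rewrite pairing_augcoord !dotv_lin (dotvC z y) vy'; field.
clearbody g g'.
have [/eqP|c1] := eqVneq (dotv g g' ^+ 2) 1; last first.
  (* With these right-hand sides both expansions vanish at z / |z|^2. If z = 0, both curvatures are
     0 and infinity is the second common point. *)
  have [z [zb zb']] := dotv_unit_solve (b / 2) (b' / 2) g1 g1' c1.
  have [z0|z0] := eqVneq z 0.
    have b0 : b = 0 by move: zb; rewrite z0 dotv0r; lra.
    have b0' : b' = 0 by move: zb'; rewrite z0 dotv0r; lra.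
    have //: None = Some y.
    by apply: uniq; rewrite pairing_augcoord ?b0 ?b0' dotv0r; lra.
  have zz : dotv z z != 0 by rewrite dotv_eq0.
  (* the second common point is the inverse of [z] in the unit sphere at [y] *)
  have [] : Some (y + (dotv z z)^-1 *: z) = Some y.
    by apply: uniq; rewrite ?move_by ?move_by' !dotv_lin ?zb ?zb'; field.
  rewrite -[RHS]addr0 => /addrI/eqP.
  by rewrite scaler_eq0 invr_eq0 (negPf zz) (negPf z0).
rewrite sqrf_eq1 => /orP[/eqP c1|/eqP //].
have eg : g = g' by apply: dotv_sub_eq0; lra.
(* A step short enough that e c <= 1 for both curvatures c, so e - c e^2 / 2 > 0: moving by e along
   the common normal enters both interiors. *)
pose e := (`|b| + `|b'| + 1)^-1.
have d0 : 0 < `|b| + `|b'| + 1 by have := normr_ge0 b; have := normr_ge0 b'; lra.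
have e0 : 0 < e by rewrite invr_gt0.
have be c : c <= `|b| + `|b'| + 1 -> 0 < e * 1 - c * (e * (e * 1)) / 2.
  move=> cb; have : c * e <= 1 by rewrite ler_pdivrMr ?mul1r.
  nra.
case: (nodis (y + e *: g)); rewrite ?move_by ?move_by' -?eg !dotv_lin g1.
  by apply: be; have := ler_norm b; have := normr_ge0 b'; lra.
by apply: be; have := ler_norm b'; have := normr_ge0 b; lra.
Qed.

End Coordinates.

(** * Descartes configurations characterized by their Gram matrix *)

Section Tangency.
Variables (R : realType) (n : nat).
Implicit Types (S : osphere R n) (D : 'I_n.+2 -> osphere R n).

(* A timelike vector, detecting which half of the light cone a null vector
   lies in. *)
Definition time_vector : 'rV[R]_n.+2 := augcoord 1 1 0.

Lemma pairing_null_time p : pairing (null_vector p) time_vector < 0.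
Proof.
case: p => [y|]; rewrite pairing_augcoord dotv0r; last lra.
by have := dotv_ge0 y; lra.
Qed.

(** A common point q satisfies <N(p), N(q)> = 0, hence q = p; and p lies on both spheres because <w,
    w + w'> = 1 - 1 = 0. *)
Lemma tangent_null_sum S S' k p : pairing (acc_coord S) (acc_coord S') = -1 ->
  k != 0 -> acc_coord S + acc_coord S' = k *: null_vector p -> tangent_at p S S'.
Proof.
move=> SS' k0 e; apply/seteqP; split=> [q [/opointsE Sq /opointsE S'q] | q ->] /=.
  apply/esym/pairing_null_eq0; apply: (mulfI k0).
  by rewrite mulr0 -pairingZl -e pairingDl Sq S'q addr0.
split; apply/opointsE; apply: (mulfI k0); rewrite mulr0 -pairingZr -e pairingDr.
  by rewrite acc_coord_norm SS' subrr.
by rewrite acc_coord_norm pairingC SS' addNr.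
Qed.

(** A common interior point would have positive product with w + w', whereas null vectors N(p), N(q)
    never have positive product. *)
Lemma disjoint_null_sum S S' k p : 0 < k ->
  acc_coord S + acc_coord S' = k *: null_vector p ->
  ointerior S `&` ointerior S' = set0.
Proof.
move=> k0 e; apply/seteqP; split=> // y [/ointeriorE Sy /ointeriorE S'y].
have := addr_gt0 Sy S'y; rewrite -pairingDl e pairingZl pmulr_rgt0 //.
by rewrite ltNge pairing_null_le0.
Qed.

Definition descartes_gram D := forall i j,
  pairing (acc_coord (D i)) (acc_coord (D j)) = if i == j then 1 else -1.

Lemma descartes_space_gram D : descartes_space D -> descartes_gram D.
Proof.
move=> [[tan _] dis] i j; case: eqVneq => [->|ij]; first exact: acc_coord_norm.
have [p tp] := tan i j ij.
have disj F : trivIset [set: 'I_n.+2] F -> F i `&` F j = set0 :> set 'rV[R]_n.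
  move=> tF; apply/seteqP; split=> // y Fy.
  by move/eqP: ij; case; apply: tF => //; exists y.
case: dis => dis; first exact: (pairing_tangent tp (disj _ dis)).
(* Reversing both spheres negates both rows, leaving the product and the point sets unchanged. *)
rewrite -pairingNN -!acc_coord_reverse; apply: (@pairing_tangent _ _ p).
  by rewrite /tangent_at !opoints_reverse.
exact: (disj (fun i => ointerior (oreverse (D i)))).
Qed.

Section OfGram.
Variable D : 'I_n.+2 -> osphere R n.
Hypotheses (n_gt0 : (0 < n)%N) (gramD : descartes_gram D).
Local Notation u i j := (acc_coord (D i) + acc_coord (D j)).

(** Pairs sharing one index give 1 - 1 - 1 - 1 = -2 and disjoint pairs give -4. This is what
    separates the points of tangency. *)
Lemma gram_pairing_sum i j k l : i != j -> k != l ->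
  [\/ i = k /\ j = l, i = l /\ j = k | pairing (u i j) (u k l) < 0].
Proof.
move=> ij kl; rewrite !pairingDl !pairingDr !gramD.
have [ik|ik] := eqVneq i k; have [jl|jl] := eqVneq j l;
have [il|il] := eqVneq i l; have [jk|jk] := eqVneq j k;
  do ?[by constructor 1|by constructor 2|by constructor 3; lra].
- by rewrite -ik -il eqxx in kl.
- by rewrite ik jk eqxx in ij.
- by rewrite il jl eqxx in ij.
- by rewrite -jk -jl eqxx in kl.
Qed.

Lemma gram_null_sum i j : i != j ->
  exists k p, k != 0 /\ u i j = k *: null_vector p.
Proof.
move=> ij; apply: null_vectorP.
  (* A third index k exists since n > 0; the sum has product -2 with row k, so it is nonzero. *)
  have /card_gt0P[k] : (0 < #|~: [set i; j]|)%N.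
    by have := cardsC [set i; j]; rewrite cards2 ij card_ord => /eqP;
       rewrite eqSS eqSS => /eqP ->.
  rewrite !inE negb_or => /andP[/negPf ki /negPf kj].
  apply/eqP => u0; 
  have := pairingDl (acc_coord (D i)) (acc_coord (D j)) (acc_coord (D k)).
  rewrite u0 -(scale0r 0) pairingZl !gramD ![_ == k]eq_sym ki kj; lra.
by rewrite !pairingDl !pairingDr !gramD !eqxx (negPf ij) eq_sym (negPf ij); ring.
Qed.

(** Sums a N(p) and b N(q) of different pairs have negative product while <N(p), N(q)> <= 0, forcing
    a b > 0. *)
Lemma gram_same_cone i j k l : i != j -> k != l ->
  0 < pairing (u i j) time_vector * pairing (u k l) time_vector.
Proof.
move=> ij kl; have [a [p [a0 ep]]] := gram_null_sum ij.
have [b [q [b0 eq]]] := gram_null_sum kl.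
have pt := pairing_null_time p; have qt := pairing_null_time q.
suff ab : 0 < a * b.
  by rewrite ep eq !pairingZl mulrACA (mulr_gt0 ab) // nmulr_rgt0.
have sq x : x != 0 -> 0 < x * x :> R by rewrite -expr2 exprn_even_gt0.
(* The same pair, possibly swapped, has product 0 with itself and is settled by comparing time
   components instead. *)
have sym : u i j = u k l -> 0 < a * b.
  move=> e; have : a * pairing (null_vector p) time_vector =
      b * pairing (null_vector q) time_vector by rewrite -!pairingZl -ep -eq e.
  move: (sq _ a0) (sq _ b0) pt qt.
  move: (pairing _ _) (pairing _ _) => x y; nra.
have [[ei ej]|[ei ej]|] := gram_pairing_sum ij kl.
- by apply: sym; rewrite ei ej.
- by apply: sym; rewrite ei ej addrC.
rewrite ep eq pairingZl pairingZr mulrA.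
by have := pairing_null_le0 p q; move: (pairing _ _) => x; nra.
Qed.

Lemma gram_descartes_space : descartes_space D.
Proof.
split; last first.
  pose i0 : 'I_n.+2 := ord0; pose i1 : 'I_n.+2 := lift ord0 ord0.
  have i01 : i0 != i1 by [].
  have kt i j k p : i != j -> u i j = k *: null_vector p ->
      0 < - (pairing (u i0 i1) time_vector * k).
    move=> ij e; have := gram_same_cone ij i01; rewrite e pairingZl.
    have := pairing_null_time p; move: (pairing _ _) (pairing _ _) => x y; nra.
  (* One reference pair decides for all: a negative time component means every factor k is positive
     and the interiors are disjoint; a positive one means the reversed interiors are. *)
  have [s|s|s] := ltrgtP (pairing (u i0 i1) time_vector) 0.
  - left=> i j _ _ [y Dy]; apply: contraPP Dy => /eqP ij.
    have [k [p [k0 e]]] := gram_null_sum ij.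
    rewrite (disjoint_null_sum _ e) //.
    by have := kt _ _ _ _ ij e; rewrite -mulNr pmulr_rgt0 ?oppr_gt0.
  - right=> i j _ _ [y Dy]; apply: contraPP Dy => /eqP ij.
    have [k [p [k0 e]]] := gram_null_sum ij.
    rewrite (@disjoint_null_sum _ _ (- k) p) //.
      by have := kt _ _ _ _ ij e; rewrite -mulrN pmulr_rgt0.
    by rewrite !acc_coord_reverse -opprD e scaleNr.
  - by have := gram_same_cone i01 i01; rewrite s mul0r ltxx.
have tan i j : i != j -> exists k p,
    u i j = k *: null_vector p /\ tangent_at p (D i) (D j).
  move=> ij; have [k [p [k0 e]]] := gram_null_sum ij; exists k, p; split=> //.
  by apply: tangent_null_sum k0 e; rewrite gramD (negPf ij).
split=> [i j /tan[k [p [_ tp]]]|i j k l p ij kl tij tkl]; first by exists p.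
have nij : i != j by rewrite -val_eqE neq_ltn ij.
have nkl : k != l by rewrite -val_eqE neq_ltn kl.
have same q i' j' : tangent_at p (D i') (D j') ->
    tangent_at q (D i') (D j') -> q = p.
  rewrite /tangent_at => -> e.
  by suff : [set p] q by []; rewrite e.
have [a [q [e /(same _ _ _ tij) qp]]] := tan _ _ nij.
have [b [r [f /(same _ _ _ tkl) rp]]] := tan _ _ nkl.
have [//|[ei ej]|] := gram_pairing_sum nij nkl.
  by move: ij; rewrite ei ej ltnNge ltnW.
(* Two different pairs tangent at the same p would have sums proportional to N(p), with product 0
   instead of negative. *)
rewrite e f qp rp pairingZl pairingZr.
have -> : pairing (null_vector p) (null_vector p) = 0 by apply/pairing_null_eq0.
by rewrite !mulr0 ltxx.
Qed.

End OfGram.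

Lemma pairing_row (W : 'M[R]_n.+2) i j :
  pairing (row i W) (row j W) = 2 * (W *m QWilker_inv R n *m W^T) i j.
Proof.
rewrite /pairing -row_mul; congr (2 * _); rewrite !mxE.
by apply: eq_bigr => k _; rewrite !mxE.
Qed.

Lemma acc_matrix_row D i : row i (acc_matrix D) = acc_coord (D i).
Proof. by rewrite rowK. Qed.

(** Each identity makes the square matrix [W] invertible, and inverting it yields the other;
    [mulmx1C] turns right inverses into left ones. *)
Lemma congr_inv_form (W : 'M[R]_n.+2) : (0 < n)%N ->
  W *m QWilker_inv R n *m W^T = QDescartes_inv R n <->
  W^T *m QDescartes R n *m W = QWilker R n.
Proof.
move=> n0; have QD := mul_QDescartes_inv R n0; have QW := mul_QWilker_inv R n.
split=> e.
  have /mulmx1C e1 : W *m (QWilker_inv R n *m W^T *m QDescartes R n) = 1%:M.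
    by rewrite !mulmxA e; apply: mulmx1C.
  have e2 : QWilker_inv R n *m (W^T *m QDescartes R n *m W) = 1%:M.
    by rewrite !mulmxA in e1 *.
  by rewrite -[LHS]mul1mx -QW -mulmxA e2 mulmx1.
have /mulmx1C e1 : W^T *m (QDescartes R n *m W *m QWilker_inv R n) = 1%:M.
  by rewrite !mulmxA e.
have e2 : QDescartes R n *m (W *m QWilker_inv R n *m W^T) = 1%:M.
  by rewrite !mulmxA in e1 *.
by rewrite -[LHS]mul1mx -(mulmx1C QD) -[LHS]mulmxA e2 mulmx1.
Qed.

Lemma QDescartes_invE i j : 2 * QDescartes_inv R n i j = if i == j then 1 else -1.
Proof. rewrite !mxE big_ord_recl big_ord0 !mxE; case: eqP => _ /=; lra. Qed.

Lemma descartes_gramP D : (0 < n)%N ->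
  descartes_gram D <->
  (acc_matrix D)^T *m QDescartes R n *m acc_matrix D = QWilker R n.
Proof.
move=> n0; rewrite -congr_inv_form //.
split=> [g|e i j]; last by rewrite -!acc_matrix_row pairing_row e QDescartes_invE.
apply/matrixP => i j; apply: (@mulfI R 2); first by rewrite pnatr_eq0.
by rewrite QDescartes_invE -pairing_row !acc_matrix_row g.
Qed.

Lemma descartes_spaceP D : (0 < n)%N ->
  descartes_space D <->
  (acc_matrix D)^T *m QDescartes R n *m acc_matrix D = QWilker R n.
Proof.
move=> n0; rewrite -descartes_gramP //; split; first exact: descartes_space_gram.
exact: gram_descartes_space.
Qed.

Lemma acc_matrix_inj : injective (@acc_matrix R n).
Proof.
move=> D D' e; apply/funext => i; apply: acc_coord_inj.
by rewrite -!acc_matrix_row e.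
Qed.

Lemma acc_matrix_surj (W : 'M[R]_n.+2) : (0 < n)%N ->
  W^T *m QDescartes R n *m W = QWilker R n -> exists D, acc_matrix D = W.
Proof.
move=> n0 /congr_inv_form e.
have /choice[D DW] i : exists S, acc_coord S = row i W.
  by apply: acc_coord_surj; rewrite pairing_row e // QDescartes_invE eqxx.
by exists D; apply/row_matrixP => i; rewrite acc_matrix_row.
Qed.

End Tangency.

(** * Congruent forms, conjugate groups and Householder reflections *)

Section Congruence.
Variables (R : realType) (k : nat).
Implicit Types (P Q U V W : 'M[R]_k).

Lemma congr_unit P Q Q' : Q \in unitmx -> P^T *m Q' *m P = Q -> P \in unitmx.
Proof. by move=> Qu e; move: Qu; rewrite -e unitmx_mul => /andP[]. Qed.

Lemma congr_trans P P' Q Q' Q'' :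
  P^T *m Q *m P = Q' -> P'^T *m Q' *m P' = Q'' ->
  (P *m P')^T *m Q *m (P *m P') = Q''.
Proof. by move=> <- <-; rewrite trmx_mul !mulmxA. Qed.

Lemma congr_invmx P Q Q' : P \in unitmx ->
  P^T *m Q *m P = Q' -> (invmx P)^T *m Q' *m invmx P = Q.
Proof.
move=> Pu <-; rewrite trmx_inv !mulmxA mulVmx ?unitmx_tr // mul1mx.
by rewrite -mulmxA mulmxV // mulmx1.
Qed.

Lemma congr_conjugate P Q Q' : P \in unitmx -> P^T *m Q' *m P = Q ->
  conjugate_in_GL (autform Q) (autform Q').
Proof.
move=> Pu e; have e' := congr_invmx Pu e.
(* Conjugation by [P] carries Aut(Q) to Aut(Q'), while the definition asks for a map from Aut(Q') to
   Aut(Q). *)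
exists (invmx P); first by rewrite unitmx_inv.
rewrite invmxK; apply/seteqP; split=> [U [Uu UQ]|_ [A [Au AQ] <-]].
  exists (P *m U *m invmx P); last by rewrite !mulmxA mulVmx // mul1mx mulmxKV.
  split; first by rewrite !unitmx_mul Pu Uu unitmx_inv.
  exact: congr_trans (congr_trans e UQ) e'.
split; first by rewrite !unitmx_mul Pu Au unitmx_inv Pu.
exact: congr_trans (congr_trans e' AQ) e.
Qed.

(** For x and y of equal length, 2 u.x = u.u with u = x - y, so the reflection in the hyperplane
    orthogonal to u sends x to y; when u = 0 the identity serves. *)
Lemma householder (x y : 'cV[R]_k) : x^T *m x = y^T *m y ->
  exists H : 'M[R]_k, H^T *m H = 1%:M /\ H^T *m x = y.
Proof.
move=> xy; pose u := x - y; pose s := (u^T *m u) 0 0.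
have uu : u^T *m u = s%:M by rewrite -mx11_scalar.
have ux : 2 *: (u^T *m x) = s%:M.
  rewrite -uu /u linearB /= !(mulmxBl, mulmxBr) xy.
  have -> : x^T *m y = y^T *m x.
    by rewrite -[LHS]trmxK trmx_mul trmxK;
    apply/matrixP => i j; rewrite !ord1 mxE.
  by rewrite scaler_nat mulr2n !opprB; apply/matrixP => i j; rewrite !mxE; ring.
have [s0|s0] := eqVneq s 0.
  exists 1%:M; rewrite trmx1 !mul1mx; split=> //.
  have : dotv u^T u^T == 0 by rewrite /dotv trmxK -/s s0.
  by rewrite dotv_eq0 trmx_eq0 subr_eq0 => /eqP.
pose H := 1%:M - (2 / s) *: (u *m u^T).
have HT : H^T = H.
  by rewrite /H linearB /= linearZ /= trmx_mul trmxK tr_scalar_mx.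
have Hx : H *m x = y.
  rewrite /H mulmxBl mul1mx -scalemxAl -mulmxA (mulrC 2) -scalerA scalemxAr ux.
  by rewrite mul_mx_scalar scalerA mulVf // scale1r subKr.
exists H; rewrite HT; split=> //.
rewrite {2}/H mulmxBr mulmx1 -scalemxAr mulmxA.
have -> : H *m u = - u.
  rewrite /H mulmxBl mul1mx -scalemxAl -mulmxA uu mul_mx_scalar scalerA divfK //.
  by rewrite scaler_nat mulr2n opprD addrA subrr sub0r.
by rewrite mulNmx scalerN opprK /H subrK.
Qed.

End Congruence.

(** * Congruence of the Descartes and Wilker forms to the Lorentz form *)

Section Models.
Variables (R : realType) (n : nat).
Local Notation N := n.+2.

Lemma QLorentzE i j :
  QLorentz R n i j = if i == j then (if i == 0 then -1 else 1) else 0.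
Proof.
rewrite !mxE; case: splitP => k ik; rewrite !mxE.
  have -> : i = 0 by apply: val_inj; rewrite /= ik ord1.
  by case: eqP.
have /negPf -> : i != 0 by rewrite -val_eqE /= ik.
by case: eqP.
Qed.

Lemma QLorentz_rank1 :
  QLorentz R n = 1%:M - 2 *: (delta_mx 0 0 *m (delta_mx 0 0 : 'cV[R]_N)^T).
Proof.
apply/matrixP => i j; rewrite QLorentzE !mxE big_ord_recl big_ord0 !mxE !andbT.
case: (eqVneq i j) => [->|]; first by case: eqP => _ /=; ring.
move=> /negPf ij; case: (eqVneq i 0) => [i0|_] /=; last by ring.
by rewrite -i0 eq_sym ij /=; ring.
Qed.

(** Both forms are the identity minus a rank-one term. An orthogonal [H] aligns the vector of ones
    with the first axis, and a dilation [D] along that axis corrects the eigenvalue. *)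
Lemma QDescartes_congr : (0 < n)%N ->
  exists P, P^T *m QLorentz R n *m P = QDescartes R n.
Proof.
move=> n0; have n0R : 0 < n%:R :> R by rewrite ltr0n.
pose e : 'cV[R]_N := delta_mx 0 0; pose o : 'cV[R]_N := const_mx 1.
have ee : e^T *m e = 1%:M.
  rewrite trmx_delta mul_delta_mx; apply/matrixP => i j.
  by rewrite !ord1 !mxE.
pose r : R := Num.sqrt N%:R.
have rr : r * r = N%:R by rewrite -expr2 sqr_sqrtr // ler0n.
have [H [HH Ho]] : exists H : 'M[R]_N, H^T *m H = 1%:M /\ H^T *m (r *: e) = o.
  apply: householder; rewrite mul_ones -scalemxAr linearZ /=
    -scalemxAl scalerA rr ee.
  by rewrite scale_scalar_mx mulr1.
have He : o *m o^T = N%:R *: (H^T *m (e *m e^T) *m H).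
  have oT : o^T = r *: (e^T *m H).
    by rewrite -Ho -scalemxAr linearZ /= trmx_mul trmxK.
  rewrite oT -Ho -!scalemxAr -scalemxAl scalerA rr.
  by rewrite !mulmxA.
(* On the vector of ones the Descartes form has eigenvalue 1 - (n+2)/n = -2/n, and dilating by s
   turns -1 into -s^2. *)
pose s : R := Num.sqrt (2 / n%:R).
have ss : s * s = 2 / n%:R by rewrite -expr2 sqr_sqrtr // divr_ge0 // ler0n.
pose D : 'M[R]_N := 1%:M + (s - 1) *: (e *m e^T).
have DT : D^T = D.
  by rewrite /D linearD /= linearZ /= trmx_mul trmxK tr_scalar_mx.
have De : D *m e = s *: e.
  by rewrite /D mulmxDl mul1mx -scalemxAl -mulmxA ee mulmx1
    scalerBl scale1r addrC subrK.
have eD : e^T *m D = s *: e^T by rewrite -[LHS]trmxK trmx_mul trmxK DT De linearZ.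
exists (D *m H); rewrite trmx_mul DT QLorentz_rank1 -/e !mulmxA.
rewrite -(mulmxA H^T D) -(mulmxA H^T) /QDescartes -/o He.
have -> : D *m (1%:M - 2 *: (e *m e^T)) *m D = 1%:M - (N%:R / n%:R) *: (e *m e^T).
  rewrite mulmxBr mulmx1 mulmxBl -scalemxAr -scalemxAl mulmxA De -!scalemxAl.
  rewrite -mulmxA eD -scalemxAr {2}/D mulmxDr mulmx1 -scalemxAr mulmxA
    De -scalemxAl {1}/D.
  apply/matrixP => i j; rewrite !mxE.
  have -> : N%:R = n%:R + 2 :> R by rewrite -addn2 natrD.
  have -> : (n%:R + 2) / n%:R = 1 + s * s by rewrite ss; field; apply: lt0r_neq0.
  by ring.
rewrite mulmxBr mulmx1 mulmxBl HH -scalemxAr -scalemxAl scalerA.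
by rewrite (mulrC n%:R^-1).
Qed.

Lemma QWilker_congr : exists P, P^T *m QLorentz R n *m P = QWilker R n.
Proof.
(* [A] has rows (1, 1) and (1, -1), so A^T diag(-1, 1) A has zero diagonal and entries -2 off it;
   the factor sqrt 2 in [P] doubles this and the identity block. *)
pose A : 'M[R]_2 := \matrix_(i, j) (if (i + j == 2)%N then -1 else 1).
pose P : 'M[R]_N := Num.sqrt 2 *: (block_mx A 0 0 1%:M : 'M_(2 + n)).
exists P.
have s2 : Num.sqrt 2 * Num.sqrt 2 = 2 :> R by rewrite -expr2 sqr_sqrtr.
have -> : QLorentz R n = block_mx
    (\matrix_(i < 2, j < 2) if i == j then (if i == 0 then -1 else 1) else 0) 0
    0 1%:M :> 'M_(2 + n).
  apply/matrixP => i j; rewrite QLorentzE.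
  case: (@split_ordP 2 n i) => k ->; case: (@split_ordP 2 n j) => l ->;
  rewrite ?(block_mxEul, block_mxEur, block_mxEdl, block_mxEdr) !mxE;
  rewrite -!val_eqE //= ?eqn_add2l.
  - by rewrite (ltn_eqF (ltn_addr _ (ltn_ord k))).
  - by rewrite (gtn_eqF (ltn_addr _ (ltn_ord l))).
  - by case: eqP.
rewrite /P -scalemxAr linearZ /= -!scalemxAl (@tr_block_mx _ 2 n 2 n).
rewrite !(@mulmx_block _ 2 n 2 n 2 n).
rewrite !(trmx0, trmx1, mulmx0, mul0mx, addr0, add0r, mulmx1).
rewrite scalerA s2 (@scale_block_mx _ 2 n 2 n) !scaler0 scale_scalar_mx mulr1.
apply: (congr1 (fun X => @block_mx R 2 n 2 n X 0 0 2%:M)).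
apply/matrixP => i j; rewrite !mxE !big_ord_recl big_ord0 !mxE
  !big_ord_recl !big_ord0 !mxE.
by case: i => [[|[|//]] ?]; case: j => [[|[|//]] ?]; rewrite !eqE /=; ring.
Qed.
End Models.

(** * From matrix actions to actions on configurations *)

Section DescartesAction.
Variables (R : realType) (n : nat).

Lemma invmxM (A B : 'M[R]_n.+2) : A \in unitmx -> B \in unitmx ->
  invmx (A *m B) = invmx B *m invmx A.
Proof. exact: invrM. Qed.

Lemma QWilker_unit : QWilker R n \in unitmx.
Proof. by case: (mulmx1_unit (mul_QWilker_inv R n)). Qed.

Lemma QDescartes_unit : (0 < n)%N -> QDescartes R n \in unitmx.
Proof. by move=> n0; case: (mulmx1_unit (mul_QDescartes_inv R n0)). Qed.

Lemma acc_matrix_unit D : (0 < n)%N -> @descartes_space R n D ->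
  acc_matrix D \in unitmx.
Proof.
by move=> n0 /(descartes_spaceP _ n0)/congr_unit; apply; apply: QWilker_unit.
Qed.

(** No spheres need be drawn: composing the two congruences through the Lorentz form gives a matrix
    W with W^T Q_D W = Q_W. *)
Lemma descartes_space_nonempty : (0 < n)%N -> @descartes_space R n !=set0.
Proof.
move=> n0; have [P PD] := QDescartes_congr R n0.
have [P' PW] := QWilker_congr R n.
have Pu := congr_unit (QDescartes_unit n0) PD.
have W := congr_trans (congr_invmx Pu PD) PW.
have [D DW] := acc_matrix_surj n0 W.
by exists D; apply/descartes_spaceP => //; rewrite DW.
Qed.

(** Transports a matrix action through the bijection between configurations and matrices; [f] is
    abstract so that left and right multiplication are both covered. *)
Lemma exists_action (G : set 'M[R]_n.+2)
    (f : 'M[R]_n.+2 -> 'M[R]_n.+2 -> 'M[R]_n.+2) : (0 < n)%N ->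
  (forall g W, G g -> W^T *m QDescartes R n *m W = QWilker R n ->
     (f g W)^T *m QDescartes R n *m f g W = QWilker R n) ->
  (forall W, f 1%:M W = W) -> G 1%:M ->
  (forall g h W, G g -> G h -> G (g *m h) /\ f (g *m h) W = f g (f h W)) ->
  (forall D D', @descartes_space R n D -> descartes_space D' ->
     exists! g, G g /\ f g (acc_matrix D) = acc_matrix D') ->
  exists act : 'M[R]_n.+2 -> ('I_n.+2 -> osphere R n) -> 'I_n.+2 -> osphere R n,
    [/\ forall g D, G g -> descartes_space D ->
          acc_matrix (act g D) = f g (acc_matrix D),
        acts_on G (@descartes_space R n) act
      & transitive_on G (@descartes_space R n) act].
Proof.
move=> n0 fW f1 G1 fM simply.
(* Choice runs over all pairs, but the value is constrained only for group elements and Descartes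
   configurations. *)
have /choice[act actE] (gD : 'M[R]_n.+2 * ('I_n.+2 -> osphere R n)) :
    exists D', gD \in [set gD | G gD.1 /\ descartes_space gD.2] ->
      acc_matrix D' = f gD.1 (acc_matrix gD.2).
  have [/set_mem[Gg /(descartes_spaceP _ n0) DX]|_] := boolP (gD \in _);
    last by exists gD.2.
  by have [D' D'W] := acc_matrix_surj n0 (fW _ _ Gg DX); exists D'.
have {}actE g D : G g -> descartes_space D ->
    acc_matrix (act (g, D)) = f g (acc_matrix D).
  by move=> Gg DX; apply: (actE (g, D)); apply/mem_set.
have actX g D : G g -> descartes_space D -> descartes_space (act (g, D)).
  move=> Gg DX; apply/(descartes_spaceP _ n0); rewrite actE //.
  by apply: fW => //; apply/(descartes_spaceP _ n0).
exists (fun g D => act (g, D)); split=> //.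
  split=> // [D DX|g h D Gg Gh DX]; apply: acc_matrix_inj; first by rewrite actE.
  have [Ggh e] := fM g h (acc_matrix D) Gg Gh.
  by rewrite !actE //; apply: actX.
split=> [|D D' DX D'X]; first exact: descartes_space_nonempty.
have [g [[Gg e] _]] := simply D D' DX D'X.
by exists g => //; apply: acc_matrix_inj; rewrite actE.
Qed.

End DescartesAction.

Theorem theorem3p2 (R : realType) (n : nat) (hn : (2 <= n)%N) :
  [/\
    conjugate_in_GL (autform (QDescartes R n)) (autform (QLorentz R n)) /\
    conjugate_in_GL (autform (QWilker R n)) (autform (QLorentz R n)),

    (exists act : 'M[R]_n.+2 -> ('I_n.+2 -> osphere R n) -> 'I_n.+2 -> osphere R n,
      [/\ forall U D, autform (QDescartes R n) U -> descartes_space D ->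
            acc_matrix (act U D) = U *m acc_matrix D,
          acts_on (autform (QDescartes R n)) (@descartes_space R n) act
        & transitive_on (autform (QDescartes R n)) (@descartes_space R n) act]) /\
    (forall D D' : 'I_n.+2 -> osphere R n,
      descartes_space D -> descartes_space D' ->
      exists! U : 'M[R]_n.+2,
        autform (QDescartes R n) U /\ U *m acc_matrix D = acc_matrix D')
  &
    (exists act : 'M[R]_n.+2 -> ('I_n.+2 -> osphere R n) -> 'I_n.+2 -> osphere R n,
      [/\ forall V D, autform (QWilker R n) V -> descartes_space D ->
            acc_matrix (act V D) = acc_matrix D *m invmx V,
          acts_on (autform (QWilker R n)) (@descartes_space R n) act
        & transitive_on (autform (QWilker R n)) (@descartes_space R n) act]) /\
    (forall D D' : 'I_n.+2 -> osphere R n,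
      descartes_space D -> descartes_space D' ->
      exists! V : 'M[R]_n.+2,
        autform (QWilker R n) V /\ acc_matrix D *m invmx V = acc_matrix D')].
Proof.
have n0 : (0 < n)%N by apply: leq_trans hn.
have spaceP D := @descartes_spaceP R n D n0.
have unitD D := @acc_matrix_unit R n D n0.
have form1 Q : autform Q (1%:M : 'M[R]_n.+2).
  by split; rewrite ?unitmx1 // trmx1 mul1mx mulmx1.
have formM Q (U V : 'M[R]_n.+2) :
    autform Q U -> autform Q V -> autform Q (U *m V).
  move=> [Uu UQ] [Vu VQ]; split; first by rewrite unitmx_mul Uu.
  exact: congr_trans UQ VQ.
have simplyD (D D' : 'I_n.+2 -> osphere R n) :
    descartes_space D -> descartes_space D' ->
    exists! U, autform (QDescartes R n) U /\ U *m acc_matrix D = acc_matrix D'.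
  move=> DX D'X; have Wu := unitD _ DX; have W'u := unitD _ D'X.
  (* The equation forces U = W' W^-1; it preserves Q_D since W' carries Q_D to Q_W and W^-1 carries
     it back. *)
  exists (acc_matrix D' *m invmx (acc_matrix D)); split; last first.
    by move=> U [_ <-]; rewrite mulmxK.
  split; last by rewrite mulmxKV.
  split; first by rewrite unitmx_mul W'u unitmx_inv.
  apply: congr_trans (_ : _ = QWilker R n) _; first exact/spaceP.
  by apply: congr_invmx => //; apply/spaceP.
have simplyW (D D' : 'I_n.+2 -> osphere R n) :
    descartes_space D -> descartes_space D' ->
    exists! V, autform (QWilker R n) V /\ acc_matrix D *m invmx V = acc_matrix D'.
  move=> DX D'X; have Wu := unitD _ DX; have W'u := unitD _ D'X.
  (* Here W V^-1 = W' forces V = W'^-1 W, which passes from Q_W through Q_D back to Q_W. *)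
  exists (invmx (acc_matrix D') *m acc_matrix D); split; last first.
    by move=> V [[Vu _] <-]; rewrite invmxM ?unitmx_inv // invmxK mulmxKV.
  split; last by rewrite invmxM ?unitmx_inv // invmxK mulKVmx.
  split; first by rewrite unitmx_mul Wu unitmx_inv W'u.
  apply: congr_trans (_ : _ = QDescartes R n) _; last exact/spaceP.
  by apply: congr_invmx => //; apply/spaceP.
split.
- have [P PD] := QDescartes_congr R n0; have [P' PW] := QWilker_congr R n.
  split; first exact: congr_conjugate (congr_unit (QDescartes_unit R n0) PD) PD.
  exact: congr_conjugate (congr_unit (QWilker_unit R n) PW) PW.
- split=> //; apply: (exists_action (f := fun U W => U *m W)) => //.
  + by move=> U W [_ UQ]; apply: congr_trans.
  + by move=> W; rewrite mul1mx.
  + by move=> U V W UQ VQ; rewrite mulmxA; split=> //; apply: formM.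
- split=> //; apply: (exists_action (f := fun V W => W *m invmx V)) => //.
  + by move=> V W [Vu VQ] WQ; apply: congr_trans WQ _; apply: congr_invmx.
  + by move=> W; rewrite invmx1 mulmx1.
  + move=> U V W UQ VQ; split; first exact: formM.
    (* Inversion reverses products, so right multiplication by V^-1 obeys the law of a left
       action. *)
    by case: UQ VQ => [Uu _] [Vu _]; rewrite invmxM // mulmxA.
Qed.
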